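(* The element $\beta=(\sigma_2^{-1}\rho_1\sigma_2\rho_3)^3\in VP_4$ lies in the kernel of the representation $\varphi_{SW}:VB_4\to\mathrm{Aut}(F_{4,5})$ as well as in the kernel of the representation $\varphi_{BD}:VB_4\to\mathrm{Aut}(F_{4,2})$, and it does not lie in the kernel of the representation $\widetilde\varphi_M:VB_4\to\mathrm{Aut}(F_{4,4})$.
   Context: Notation: $a^b=b^{-1}ab$, $a^{-b}=(a^{-1})^b$. Automorphisms act on the right: a product $\varphi\psi$ means first $\varphi$, then $\psi$. Unlisted generators are fixed; $1\le i\le n-1$. The virtual braid group $VB_n$ is generated by $\sigma_1,\dots,\sigma_{n-1},\rho_1,\dots,\rho_{n-1}$ with defining relations: $\sigma_i\sigma_{i+1}\sigma_i=\sigma_{i+1}\sigma_i\sigma_{i+1}$, $\rho_i\rho_{i+1}\rho_i=\rho_{i+1}\rho_i\rho_{i+1}$, $\rho_i\rho_{i+1}\sigma_i=\sigma_{i+1}\rho_i\rho_{i+1}$ for $1\le i\le n-2$; $\sigma_i\sigma_j=\sigma_j\sigma_i$, $\rho_i\rho_j=\rho_j\rho_i$, $\sigma_i\rho_j=\rho_j\sigma_i$ for $|i-j|\ge 2$; $\rho_i^2=1$. The virtual pure braid group $VP_n$ is the kernel of the homomorphism $VB_n\to S_n$, $\sigma_i\mapsto\rho_i$, $\rho_i\mapsto\rho_i$, where $\rho_i$ is identified with the transposition $(i,i+1)$. $F_{n,k}=F_n*\mathbb{Z}^k$ is the free product of a free group of rank $n$ and a free abelian group of rank $k$. $\varphi_{SW}:VB_n\to\mathrm{Aut}(F_{n,n+1})$,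 where $F_n=\langle x_1,\dots,x_n\rangle$, $\mathbb{Z}^{n+1}=\langle v,u_1,\dots,u_n\rangle$: $\varphi_{SW}(\sigma_i): x_i\mapsto x_ix_{i+1}^{u_i}x_i^{-vu_{i+1}},\ x_{i+1}\mapsto x_i^{v},\ u_i\leftrightarrow u_{i+1}$; $\varphi_{SW}(\rho_i): x_i\leftrightarrow x_{i+1},\ u_i\leftrightarrow u_{i+1}$. $\varphi_{BD}:VB_n\to\mathrm{Aut}(F_{n,2})$, where $F_n=\langle x_1,\dots,x_n\rangle$, $\mathbb{Z}^{2}=\langle u,v\rangle$: $\varphi_{BD}(\sigma_i): x_i\mapsto x_ix_{i+1}x_i^{-u},\ x_{i+1}\mapsto x_i^{u}$; $\varphi_{BD}(\rho_i): x_i\mapsto x_{i+1}^{v^{-1}},\ x_{i+1}\mapsto x_i^{v}$. $\widetilde\varphi_M:VB_n\to\mathrm{Aut}(F_{n,n})$, where $F_n=\langle y_1,\dots,y_n\rangle$, $\mathbb{Z}^n=\langle v_1,\dots,v_n\rangle$: $\widetilde\varphi_M(\sigma_i): y_i\mapsto y_iy_{i+1}y_i^{-1},\ y_{i+1}\mapsto y_i,\ v_i\leftrightarrow v_{i+1}$; $\widetilde\varphi_M(\rho_i): y_i\mapsto y_{i+1}^{v_i^{-1}},\ y_{i+1}\mapsto y_i^{v_{i+1}},\ v_i\leftrightarrow v_{i+1}$. *)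

(* Defs.v *)
From HB Require Import structures.
From mathcomp Require Import all_boot fingroup perm.
From mathcomp Require Import zify boolp.

Set Implicit Arguments.
Unset Strict Implicit.
Unset Printing Implicit Defensive.

Local Open Scope group_scope.
Local Open Scope quotient_scope.

Notation "{ 'gmorphism' G -> H }" := (UMagmaMorphism.type G H)
  (at level 0, G at level 98, H at level 99) : type_scope.

Definition kernel (G H : groupType) (f : {gmorphism G -> H}) : {pred G} :=
  [pred x | f x == 1].

Section Presentation.
Variable X : choiceType.

(* The letter (false, x) stands for the generator x, and (true, x) for x^-1. *)
Definition word := seq (bool * X).

Definition word_inv (w : word) : word := rev [seq (~~ l.1, l.2) | l <- w].

Variable R : word -> word -> Prop.

(* The congruence on words generated by free cancellation and by R. *)
Inductive weq : word -> word -> Prop :=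
| weq_refl w : weq w w
| weq_sym u w : weq u w -> weq w u
| weq_trans u v w : weq u v -> weq v w -> weq u w
| weq_cat u u' w w' : weq u u' -> weq w w' -> weq (u ++ w) (u' ++ w')
| weq_cancel b x : weq [:: (b, x); (~~ b, x)] [::]
| weq_rel u w : R u w -> weq u w.

Definition weqb (u w : word) : bool := `[< weq u w >].

Fact weqb_equiv : equiv_class_of weqb.
Proof.
split=> [w|u w|v u w]; first by apply/asboolP; apply: weq_refl.
  by apply/asboolP/asboolP; apply: weq_sym.
by move=> /asboolP uv /asboolP vw; apply/asboolP; apply: weq_trans uv vw.
Qed.

Definition weq_equiv := EquivRelPack weqb_equiv.

Definition presented : Type := {eq_quot weq_equiv}.
HB.instance Definition _ := Choice.on presented.

Definition pclass (w : word) : presented := \pi_({eq_quot weq_equiv}) w.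
Definition prepr (g : presented) : word :=
  generic_quotient.repr (g : {eq_quot weq_equiv}).

Lemma preprK g : pclass (prepr g) = g.
Proof. exact: reprK. Qed.

Lemma pclassP u w : pclass u = pclass w <-> weq u w.
Proof.
split=> [/eqmodP/asboolP //|uw]; apply/eqmodP; exact/asboolP.
Qed.

Lemma weq_prepr w : weq (prepr (pclass w)) w.
Proof. by apply/pclassP; rewrite preprK. Qed.

Definition pmul (g h : presented) : presented := pclass (prepr g ++ prepr h).
Definition pinv (g : presented) : presented := pclass (word_inv (prepr g)).

Lemma pmulE u w : pmul (pclass u) (pclass w) = pclass (u ++ w).
Proof. by apply/pclassP/weq_cat; apply: weq_prepr. Qed.

Lemma word_inv_cons l w : word_inv (l :: w) = word_inv w ++ [:: (~~ l.1, l.2)].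
Proof. by rewrite /word_inv /= rev_cons cats1. Qed.

Lemma weq_mulV w : weq (w ++ word_inv w) [::].
Proof.
elim: w => [|[b x] w IHw]; first exact: weq_refl.
rewrite word_inv_cons -cat1s -catA [w ++ _]catA /=.
apply: weq_trans (weq_cancel b x).
apply: (@weq_cat [:: (b, x)] [:: (b, x)]); first exact: weq_refl.
exact: (@weq_cat _ [::]) IHw (weq_refl _).
Qed.

Lemma weq_mulVl w : weq (word_inv w ++ w) [::].
Proof.
have wK : word_inv (word_inv w) = w.
  rewrite /word_inv map_rev revK -map_comp map_id_in // => -[b x] _ /=.
  by rewrite negbK.
by rewrite -{2}wK; apply: weq_mulV.
Qed.

Fact pmulA : associative pmul.
Proof.
move=> g h k; rewrite -[g]preprK -[h]preprK -[k]preprK.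
by rewrite !pmulE catA.
Qed.

Fact pmul1g : left_id (pclass [::]) pmul.
Proof. by move=> g; rewrite -[g]preprK pmulE. Qed.

Fact pmulg1 : right_id (pclass [::]) pmul.
Proof. by move=> g; rewrite -[g]preprK pmulE cats0. Qed.

Fact pmulVg : left_inverse (pclass [::]) pinv pmul.
Proof.
by move=> g; rewrite -{2}[g]preprK pmulE; apply/pclassP/weq_mulVl.
Qed.

Fact pmulgV : right_inverse (pclass [::]) pinv pmul.
Proof.
by move=> g; rewrite -{1}[g]preprK pmulE; apply/pclassP/weq_mulV.
Qed.

HB.instance Definition _ := isGroup.Build presented
  pmulA pmul1g pmulg1 pmulVg pmulgV.

Definition pgen (x : X) : presented := pclass [:: (false, x)].

Section Lift.
Variables (H : groupType) (f : X -> H).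

Definition word_eval (w : word) : H :=
  \prod_(l <- w) (if l.1 then (f l.2)^-1 else f l.2).

Hypothesis fR : forall u w, R u w -> word_eval u = word_eval w.

Lemma word_eval_weq u w : weq u w -> word_eval u = word_eval w.
Proof.
elim=> {u w} // [u v w _ -> _ -> //|u u' w w' _ e _ e'|b x].
  by rewrite /word_eval !big_cat /= -!/(word_eval _) e e'.
rewrite /word_eval !big_cons !big_nil /= mulg1.
by case: b; rewrite /= ?mulVg ?mulgV.
Qed.

Definition plift_fun (g : presented) : H := word_eval (prepr g).

Lemma plift_fun_class w : plift_fun (pclass w) = word_eval w.
Proof. exact/word_eval_weq/weq_prepr. Qed.

Fact plift_funM : {morph plift_fun : g h / g * h}.
Proof.
move=> g h; rewrite -[g]preprK -[h]preprK [_ * _]pmulE !plift_fun_class.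
by rewrite /word_eval big_cat.
Qed.

Fact plift_fun1 : plift_fun 1 = 1.
Proof. by rewrite plift_fun_class /word_eval big_nil. Qed.

HB.instance Definition _ :=
  isUMagmaMorphism.Build presented H plift_fun (conj plift_fun1 plift_funM).

Definition plift : {gmorphism presented -> H} := plift_fun.

Lemma plift_gen x : plift (pgen x) = f x.
Proof.
by rewrite /= plift_fun_class /word_eval big_cons big_nil /= mulg1.
Qed.

End Lift.

Lemma presented_ext (H : groupType) (f g : {gmorphism presented -> H}) :
  (forall x, f (pgen x) = g (pgen x)) -> f =1 g.
Proof.
move=> fg h; rewrite -[h]preprK; elim: (prepr h) => [|[b x] w IHw].
  by rewrite -[pclass _]/(1 : presented) !gmulf1.
have -> : pclass ((b, x) :: w) = (if b then (pgen x)^-1 else pgen x) * pclass w.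
  rewrite -cat1s -pmulE; congr (_ * _); case: b => //.
  apply: (@mulgI _ (pgen x)); rewrite mulgV; rewrite [_ * _]pmulE.
  exact/pclassP/(weq_cancel false).
by rewrite !gmulfM IHw; congr (_ * _); case: b; rewrite ?gmulfV fg.
Qed.

End Presentation.

Definition free_group (X : choiceType) := @presented X (fun _ _ => False).

Variant comm_rel (X : choiceType) : word X -> word X -> Prop :=
| CommRel x y :
    comm_rel [:: (false, x); (false, y)] [:: (false, y); (false, x)].

Definition free_abelian (X : choiceType) := presented (@comm_rel X).

Variant free_prod_rel (G H : groupType) :
    word (G + H)%type -> word (G + H)%type -> Prop :=
| FreeProdL (a b : G) :
    free_prod_rel [:: (false, inl a); (false, inl b)] [:: (false, inl (a * b))]
| FreeProdR (a b : H) :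
    free_prod_rel [:: (false, inr a); (false, inr b)] [:: (false, inr (a * b))].

Definition free_prod (G H : groupType) := presented (@free_prod_rel G H).

HB.instance Definition _ X := Group.on (free_group X).
HB.instance Definition _ X := Group.on (free_abelian X).
HB.instance Definition _ G H := Group.on (free_prod G H).

Section FreeProductLift.
Variables (n k : nat).

Definition Fnk := free_prod (free_group 'I_n) (free_abelian 'I_k).
HB.instance Definition _ := Group.on Fnk.

(* The basis of F_n, and the basis of Z^k (whose operation is written
   multiplicatively), as elements of F_n * Z^k. *)
Definition x_ (j : 'I_n) : Fnk := pgen _ (inl (pgen _ j : free_group 'I_n)).
Definition z_ (i : 'I_k) : Fnk := pgen _ (inr (pgen _ i : free_abelian 'I_k)).

Lemma free_prod_inlM (G H : groupType) (a b : G) :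
  pgen (@free_prod_rel G H) (inl (a * b)) = pgen _ (inl a) * pgen _ (inl b).
Proof.
apply/esym; apply: etrans (pmulE _ _ _) _; apply/pclassP/weq_rel; constructor.
Qed.

Lemma free_prod_inrM (G H : groupType) (a b : H) :
  pgen (@free_prod_rel G H) (inr (a * b)) = pgen _ (inr a) * pgen _ (inr b).
Proof.
apply/esym; apply: etrans (pmulE _ _ _) _; apply/pclassP/weq_rel; constructor.
Qed.

Lemma z_comm i j : commute (z_ i) (z_ j).
Proof.
rewrite /commute -!free_prod_inrM; congr (pgen _ (inr _)).
rewrite [LHS]pmulE [RHS]pmulE; apply/pclassP/weq_rel; constructor.
Qed.

Section Lift.
Variables (H : groupType) (a : 'I_n -> H) (c : 'I_k -> H).
Hypothesis cC : forall i j, commute (c i) (c j).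

Fact free_lift_subproof (u w : word 'I_n) :
  False -> word_eval a u = word_eval a w.
Proof. by []. Qed.

Fact free_abelian_lift_subproof (u w : word 'I_k) :
  comm_rel u w -> word_eval c u = word_eval c w.
Proof.
by case=> i j; rewrite /word_eval !big_cons !big_nil /= !mulg1 cC.
Qed.

Definition free_prod_gen (g : free_group 'I_n + free_abelian 'I_k) : H :=
  match g with
  | inl g => plift free_lift_subproof g
  | inr g => plift free_abelian_lift_subproof g
  end.

Fact free_prod_lift_subproof (u w : word _) :
  free_prod_rel u w -> word_eval free_prod_gen u = word_eval free_prod_gen w.
Proof.
by case=> g h; rewrite /word_eval !big_cons !big_nil !mulg1 /free_prod_gen;
  rewrite [RHS]gmulfM.
Qed.

Definition Flift : {gmorphism Fnk -> H} := plift free_prod_lift_subproof.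

Lemma Flift_x j : Flift (x_ j) = a j.
Proof. by rewrite [LHS]plift_gen [LHS]plift_gen. Qed.

Lemma Flift_z i : Flift (z_ i) = c i.
Proof. by rewrite [LHS]plift_gen [LHS]plift_gen. Qed.

End Lift.

Section Inclusions.
Variables (H : groupType) (f : {gmorphism Fnk -> H}).

Let fl (g : free_group 'I_n) : H := f (pgen _ (inl g)).
Let fr (g : free_abelian 'I_k) : H := f (pgen _ (inr g)).

Fact incl_left_subproof : {morph fl : g h / g / h}.
Proof.
move=> g h; rewrite /fl; apply: (@mulIg _ (fl h)).
by rewrite mulgVK -gmulfM -free_prod_inlM mulgVK.
Qed.

Fact incl_right_subproof : {morph fr : g h / g / h}.
Proof.
move=> g h; rewrite /fr; apply: (@mulIg _ (fr h)).
by rewrite mulgVK -gmulfM -free_prod_inrM mulgVK.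
Qed.

HB.instance Definition _ :=
  isGroupMorphism.Build (free_group 'I_n) H fl incl_left_subproof.
HB.instance Definition _ :=
  isGroupMorphism.Build (free_abelian 'I_k) H fr incl_right_subproof.

Definition res_left : {gmorphism free_group 'I_n -> H} := fl.
Definition res_right : {gmorphism free_abelian 'I_k -> H} := fr.

End Inclusions.

Lemma Fnk_ext (H : groupType) (f g : {gmorphism Fnk -> H}) :
  (forall j, f (x_ j) = g (x_ j)) -> (forall i, f (z_ i) = g (z_ i)) ->
  f =1 g.
Proof.
move=> fgx fgz; apply: presented_ext => -[h|h].
  exact: (@presented_ext _ _ _ (res_left f) (res_left g) fgx).
exact: (@presented_ext _ _ _ (res_right f) (res_right g) fgz).
Qed.

End FreeProductLift.

Section Automorphisms.
Variable G : groupType.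

Definition is_aut : pred (G -> G) :=
  fun f => `[< {morph f : x y / x * y} /\ bijective f >].

Record aut := Aut { aut_fun :> G -> G; _ : is_aut aut_fun }.
HB.instance Definition _ := [isSub for aut_fun].
HB.instance Definition _ := [Choice of aut by <:].

Lemma autM (f : aut) : {morph f : x y / x * y}.
Proof. by case: f => f /= /asboolP[]. Qed.

Lemma aut_bij (f : aut) : bijective f.
Proof. by case: f => f /= /asboolP[]. Qed.

Lemma aut_eqP (f g : aut) : f =1 g -> f = g.
Proof. by move=> fg; apply/val_inj/funext. Qed.

Lemma is_autP f : {morph f : x y / x * y} -> bijective f -> is_aut f.
Proof. by move=> fM fB; apply/asboolP. Qed.

(* Automorphisms act on the right: the product f * g is f followed by g. *)
Fact aut_mul_subproof (f g : aut) : is_aut (g \o f).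
Proof.
apply: is_autP; first by move=> x y /=; rewrite !autM.
by apply: bij_comp; apply: aut_bij.
Qed.
Definition aut_mul f g := Aut (aut_mul_subproof f g).

Fact aut_one_subproof : is_aut id.
Proof. by apply: is_autP => //; exists id. Qed.
Definition aut_one := Aut aut_one_subproof.

Fact aut_inv_exists (f : aut) : exists g : aut, cancel f g /\ cancel g f.
Proof.
have [g fK gK] := aut_bij f.
have gP : is_aut g.
  apply: is_autP; last by exists f.
  by move=> x y; apply: (can_inj fK); rewrite autM !gK.
by exists (Aut gP).
Qed.
Definition aut_inv (f : aut) : aut := sval (cid (aut_inv_exists f)).

Lemma aut_invK (f : aut) : cancel f (aut_inv f) /\ cancel (aut_inv f) f.
Proof. exact: svalP (cid (aut_inv_exists f)). Qed.

Fact aut_mulA : associative aut_mul.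
Proof. by move=> f g h; apply: aut_eqP. Qed.
Fact aut_mul1 : left_id aut_one aut_mul.
Proof. by move=> f; apply: aut_eqP. Qed.
Fact aut_mulr1 : right_id aut_one aut_mul.
Proof. by move=> f; apply: aut_eqP. Qed.
Fact aut_mulV : left_inverse aut_one aut_inv aut_mul.
Proof. by move=> f; apply: aut_eqP => x /=; rewrite (aut_invK f).2. Qed.
Fact aut_mulVr : right_inverse aut_one aut_inv aut_mul.
Proof. by move=> f; apply: aut_eqP => x /=; rewrite (aut_invK f).1. Qed.

HB.instance Definition _ := isGroup.Build aut
  aut_mulA aut_mul1 aut_mulr1 aut_mulV aut_mulVr.

Lemma aut_mulE (f g : aut) x : (f * g) x = g (f x).
Proof. by []. Qed.

Lemma aut_oneE x : (1 : aut) x = x.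
Proof. by []. Qed.

Section AutMorphism.
Variable f : aut.
Fact aut_fun1 : f 1 = 1.
Proof. by apply: (@mulgI _ (f 1)); rewrite -autM !mulg1. Qed.
HB.instance Definition _ :=
  isUMagmaMorphism.Build G G f (conj aut_fun1 (autM f)).
Definition aut_morph : {gmorphism G -> G} := f.
End AutMorphism.

End Automorphisms.

Section Substitutions.
Variables n k : nat.
Implicit Types (a : 'I_n -> Fnk n k) (p : {perm 'I_k}).

Fact subst_subproof p i j : commute (z_ n (p i)) (z_ n (p j)).
Proof. exact: z_comm. Qed.

(* The endomorphism x_j |-> a j, z_i |-> z_(p i). *)
Definition subst a p : {gmorphism Fnk n k -> Fnk n k} :=
  Flift a (subst_subproof p).

Lemma subst_x a p j : subst a p (x_ k j) = a j.
Proof. exact: Flift_x. Qed.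

Lemma subst_z a p i : subst a p (z_ n i) = z_ n (p i).
Proof. exact: Flift_z. Qed.

Lemma subst_bij a p b q :
    (forall j, subst b q (a j) = x_ k j) ->
    (forall j, subst a p (b j) = x_ k j) ->
    (forall i, q (p i) = i) ->
  bijective (subst a p).
Proof.
move=> ab ba pq; have qp i : p (q i) = i.
  by apply: (@perm_inj _ q); rewrite pq.
by exists (subst b q) => x;
  [ apply: (@Fnk_ext _ _ _ (subst b q \o subst a p) idfun)
  | apply: (@Fnk_ext _ _ _ (subst a p \o subst b q) idfun)] => j /=;
  rewrite ?subst_x ?subst_z ?ab ?ba ?pq ?qp.
Qed.

Fact subst_aut_subproof a p : bijective (subst a p) -> is_aut (subst a p).
Proof. by apply: is_autP; apply: gmulfM. Qed.

Definition subst_aut a p (ap_bij : bijective (subst a p)) : aut (Fnk n k) :=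
  Aut (subst_aut_subproof ap_bij).

Lemma aut_Fnk_ext (f g : aut (Fnk n k)) :
  (forall j, f (x_ k j) = g (x_ k j)) -> (forall i, f (z_ n i) = g (z_ n i)) ->
  f = g.
Proof.
move=> fgx fgz; apply: aut_eqP.
exact: (@Fnk_ext _ _ _ (aut_morph f) (aut_morph g)).
Qed.

End Substitutions.

Section VirtualBraidGroup.
Variable n : nat.

(* The generator of index i : 'I_n.-1 acts on the strands lo i and hi i, i.e.,
   on the i-th and (i+1)-st ones; all indices are shifted to start from 0. *)
Fact lo_subproof (i : 'I_n.-1) : i < n.
Proof. by case: n i => [[]//|m] i; apply: ltnW; rewrite ltnS. Qed.
Fact hi_subproof (i : 'I_n.-1) : i.+1 < n.
Proof. by case: n i => [[]//|m] i; rewrite ltnS. Qed.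
Definition lo (i : 'I_n.-1) : 'I_n := Ordinal (lo_subproof i).
Definition hi (i : 'I_n.-1) : 'I_n := Ordinal (hi_subproof i).

Definition far (i j : 'I_n.-1) : bool := (i.+1 < j) || (j.+1 < i).

Definition VBgen : choiceType := ('I_n.-1 + 'I_n.-1)%type.

Definition sigmaL (i : 'I_n.-1) : bool * VBgen := (false, inl i).
Definition rhoL (i : 'I_n.-1) : bool * VBgen := (false, inr i).
Local Notation s := sigmaL.
Local Notation r := rhoL.

Variant VB_rel : word VBgen -> word VBgen -> Prop :=
| VB_sss (i j : 'I_n.-1) of j = i.+1 :> nat :
    VB_rel [:: s i; s j; s i] [:: s j; s i; s j]
| VB_rrr (i j : 'I_n.-1) of j = i.+1 :> nat :
    VB_rel [:: r i; r j; r i] [:: r j; r i; r j]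
| VB_rrs (i j : 'I_n.-1) of j = i.+1 :> nat :
    VB_rel [:: r i; r j; s i] [:: s j; r i; r j]
| VB_ss i j of far i j : VB_rel [:: s i; s j] [:: s j; s i]
| VB_rr i j of far i j : VB_rel [:: r i; r j] [:: r j; r i]
| VB_sr i j of far i j : VB_rel [:: s i; r j] [:: r j; s i]
| VB_r2 i : VB_rel [:: r i; r i] [::].

Definition VB := presented VB_rel.
HB.instance Definition _ := Group.on VB.

Definition sigma (i : 'I_n.-1) : VB := pgen VB_rel (inl i).
Definition rho (i : 'I_n.-1) : VB := pgen VB_rel (inr i).

Record VB_relations (H : groupType) (sg rh : 'I_n.-1 -> H) : Prop :=
  VBRelations {
  VB_relations_sss : forall i j : 'I_n.-1, j = i.+1 :> nat ->
    sg i * sg j * sg i = sg j * sg i * sg j;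
  VB_relations_rrr : forall i j : 'I_n.-1, j = i.+1 :> nat ->
    rh i * rh j * rh i = rh j * rh i * rh j;
  VB_relations_rrs : forall i j : 'I_n.-1, j = i.+1 :> nat ->
    rh i * rh j * sg i = sg j * rh i * rh j;
  VB_relations_ss : forall i j, far i j -> sg i * sg j = sg j * sg i;
  VB_relations_rr : forall i j, far i j -> rh i * rh j = rh j * rh i;
  VB_relations_sr : forall i j, far i j -> sg i * rh j = rh j * sg i;
  VB_relations_r2 : forall i, rh i * rh i = 1 }.

Section Lift.
Variables (H : groupType) (sg rh : 'I_n.-1 -> H) (srP : VB_relations sg rh).

Definition VB_gen_img (g : VBgen) : H :=
  match g with inl i => sg i | inr i => rh i end.

Fact VB_lift_subproof (u w : word VBgen) :
  VB_rel u w -> word_eval VB_gen_img u = word_eval VB_gen_img w.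
Proof.
case: srP => sss rrr rrs ss rr sr r2.
by case=> [i j ij|i j ij|i j ij|i j ij|i j ij|i j ij|i];
  rewrite /word_eval !big_cons !big_nil /= !mulg1 ?mulgA; auto.
Qed.

Definition VB_lift : {gmorphism VB -> H} := plift VB_lift_subproof.

Lemma VB_lift_sigma i : VB_lift (sigma i) = sg i.
Proof. exact: plift_gen. Qed.

Lemma VB_lift_rho i : VB_lift (rho i) = rh i.
Proof. exact: plift_gen. Qed.

End Lift.

Lemma lo_hi i : lo i != hi i.
Proof. by rewrite -val_eqE /= neq_ltn ltnSn. Qed.

Lemma far_neq i j : far i j ->
  [/\ lo i != lo j, lo i != hi j, hi i != lo j & hi i != hi j].
Proof.
by rewrite /far -!val_eqE /= => ij; split; apply: contraTneq ij; lia.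
Qed.

Lemma succ_lo_hi (i j : 'I_n.-1) : j = i.+1 :> nat ->
  [/\ lo j = hi i, lo i != hi j & hi i != hi j].
Proof. by move=> ij; rewrite -!val_eqE /=; split; [apply: val_inj|lia|lia]. Qed.

Section Transpositions.
Variables (m : nat) (f : 'I_n -> 'I_m).
Hypothesis f_inj : injective f.

Definition transp (i : 'I_n.-1) : {perm 'I_m} := tperm (f (lo i)) (f (hi i)).

Lemma transp_braid (i j : 'I_n.-1) : j = i.+1 :> nat ->
  transp i * transp j * transp i = transp j * transp i * transp j.
Proof.
move=> /succ_lo_hi[e ik jk]; have ij := lo_hi i; rewrite /transp e.
move: ik jk ij; rewrite -!(inj_eq f_inj) => /eqP ik /eqP jk /eqP ij.
apply/permP => x; rewrite !permM.
by repeat case: tpermP; intros; congruence.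
Qed.

Lemma transp_far i j : far i j -> transp i * transp j = transp j * transp i.
Proof.
move=> /far_neq[]; rewrite -!(inj_eq f_inj) => /eqP a /eqP b /eqP c /eqP d.
apply/permP => x; rewrite !permM /transp.
by repeat case: tpermP; intros; congruence.
Qed.

Lemma transp2 i : transp i * transp i = 1.
Proof. exact: tperm2. Qed.

Lemma transp_relations : VB_relations transp transp.
Proof.
by split; [exact: transp_braid|exact: transp_braid|exact: transp_braid|
  exact: transp_far|exact: transp_far|exact: transp_far|exact: transp2].
Qed.

End Transpositions.

Definition VB_perm : {gmorphism VB -> {perm 'I_n}} :=
  VB_lift (transp_relations (@inj_id 'I_n)).

Definition VP : {pred VB} := kernel VB_perm.

End VirtualBraidGroup.

Arguments VP : clear implicits.

(* A decision procedure for equalities of monomials in F_n * Z^k. *)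
Section Normalization.
Variables n k : nat.

Inductive mono :=
| MonoX of nat
| MonoZ of nat
| MonoMul of mono & mono
| MonoInv of mono
| MonoOne.

(* (is_z, index, is_inverted) *)
Definition letter := (bool * nat * bool)%type.

Fixpoint mono_word (inverted : bool) (e : mono) : seq letter :=
  match e with
  | MonoX j => [:: (false, j, inverted)]
  | MonoZ j => [:: (true, j, inverted)]
  | MonoMul e1 e2 =>
    if inverted then mono_word true e2 ++ mono_word true e1
    else mono_word false e1 ++ mono_word false e2
  | MonoInv e => mono_word (~~ inverted) e
  | MonoOne => [::]
  end.

Fixpoint insert_letter (l : letter) (w : seq letter) : seq letter :=
  if w is m :: w' then
    if m == (l.1, ~~ l.2) then w'
    else if [&& l.1.1, m.1.1 & m.1.2 < l.1.2] then m :: insert_letter l w'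
    else l :: w
  else [:: l].

Definition mono_norm (e : mono) := foldr insert_letter [::] (mono_word false e).

Variables (xs : seq 'I_n) (zs : seq 'I_k).

Definition atom_eval (l : bool * nat) : Fnk n k :=
  if l.1 then oapp (@z_ n k) 1 (onth zs l.2)
  else oapp (@x_ n k) 1 (onth xs l.2).

Definition letter_eval (l : letter) : Fnk n k :=
  if l.2 then (atom_eval l.1)^-1 else atom_eval l.1.

Fixpoint letters_eval (w : seq letter) : Fnk n k :=
  if w is l :: w then letter_eval l * letters_eval w else 1.

Fixpoint mono_eval (e : mono) : Fnk n k :=
  match e with
  | MonoX j => atom_eval (false, j)
  | MonoZ j => atom_eval (true, j)
  | MonoMul e1 e2 => mono_eval e1 * mono_eval e2
  | MonoInv e => (mono_eval e)^-1
  | MonoOne => 1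
  end.

Lemma letters_eval_cat w1 w2 :
  letters_eval (w1 ++ w2) = letters_eval w1 * letters_eval w2.
Proof. by elim: w1 => [|l w1 IHw] /=; rewrite ?mul1g // IHw mulgA. Qed.

Lemma mono_wordP b e :
  letters_eval (mono_word b e) = if b then (mono_eval e)^-1 else mono_eval e.
Proof.
elim: e b => [j|j|e1 IH1 e2 IH2|e IHe|] [] //=; rewrite ?mulg1 ?invg1 //.
all: by rewrite ?letters_eval_cat ?IH1 ?IH2 ?IHe ?invgM ?invgK.
Qed.

Lemma letter_commute (l m : letter) : l.1.1 -> m.1.1 ->
  commute (letter_eval l) (letter_eval m).
Proof.
case: l m => [[[] i] b] [[[] j] c] // _ _.
have ij : commute (atom_eval (true, i)) (atom_eval (true, j)).
  rewrite /atom_eval /=; case: (onth zs i) => [s|] /=; last exact/esym/commute1.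
  by case: (onth zs j) => [t|] /=; [apply: z_comm|apply: commute1].
have ji := esym ij.
rewrite /letter_eval /=; case: b c => -[] //; try exact: commuteV.
  by apply: commuteV; apply: commute_sym; apply: commuteV.
by apply: commute_sym; apply: commuteV.
Qed.

Lemma insert_letterP l w :
  letters_eval (insert_letter l w) = letter_eval l * letters_eval w.
Proof.
elim: w => [//|m w IHw] /=; case: eqP => [->|_].
  by rewrite /letter_eval; case: l.2; rewrite /= ?mulKg ?mulVKg.
case: ifP => //= /and3P[lz mz _].
by rewrite IHw !mulgA (letter_commute mz lz).
Qed.

Lemma mono_normP e : letters_eval (mono_norm e) = mono_eval e.
Proof.
rewrite -(mono_wordP false) /mono_norm.
by elim: (mono_word _ _) => //= l w IHw; rewrite insert_letterP IHw.
Qed.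

Lemma mono_eq e1 e2 :
  mono_norm e1 = mono_norm e2 -> mono_eval e1 = mono_eval e2.
Proof. by rewrite -!mono_normP => ->. Qed.

End Normalization.

Ltac mono_index x xs :=
  match xs with
  | x :: _ => constr:(0)
  | _ :: ?xs => let i := mono_index x xs in constr:(i.+1)
  end.

Ltac mono_add x xs :=
  match xs with
  | _ => let i := mono_index x xs in xs
  | _ => constr:(x :: xs)
  end.

Ltac mono_xs t xs :=
  match t with
  | mul ?a ?b => let xs := mono_xs a xs in mono_xs b xs
  | inv ?a => mono_xs a xs
  | x_ _ ?j => mono_add j xs
  | _ => xs
  end.

Ltac mono_zs t zs :=
  match t with
  | mul ?a ?b => let zs := mono_zs a zs in mono_zs b zs
  | inv ?a => mono_zs a zs
  | z_ _ ?j => mono_add j zs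
  | _ => zs
  end.

Ltac mono_reify t xs zs :=
  match t with
  | mul ?a ?b =>
    let a := mono_reify a xs zs in let b := mono_reify b xs zs in
    constr:(MonoMul a b)
  | inv ?a => let a := mono_reify a xs zs in constr:(MonoInv a)
  | x_ _ ?j => let i := mono_index j xs in constr:(MonoX i)
  | z_ _ ?j => let i := mono_index j zs in constr:(MonoZ i)
  | one => constr:(MonoOne)
  end.

Ltac mono_solve :=
  match goal with
  | |- _ => reflexivity
  | |- @eq _ ?l ?r =>
    match type of l with
    | context [Fnk ?n ?k] =>
      let xs := mono_xs l (@nil 'I_n) in let xs := mono_xs r xs in
      let zs := mono_zs l (@nil 'I_k) in let zs := mono_zs r zs in
      let el := mono_reify l xs zs in let er := mono_reify r xs zs in
      exact (@mono_eq n k xs zs el er (erefl _))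
    end
  end.

Section LocalMoves.
Variables n k : nat.

(* x_i |-> e, x_(i+1) |-> e', the other generators x_j being fixed. *)
Definition move2 (i : 'I_n.-1) (e e' : Fnk n k) (j : 'I_n) : Fnk n k :=
  if j == lo i then e else if j == hi i then e' else x_ k j.

Lemma move2_lo i e e' : move2 i e e' (lo i) = e.
Proof. by rewrite /move2 eqxx. Qed.

Lemma move2_hi i e e' : move2 i e e' (hi i) = e'.
Proof. by rewrite /move2 eqxx eq_sym (negbTE (lo_hi i)). Qed.

Lemma move2_fix i e e' j : j != lo i -> j != hi i -> move2 i e e' j = x_ k j.
Proof. by rewrite /move2 => /negbTE-> /negbTE->. Qed.

Lemma subst_autE (a : 'I_n -> Fnk n k) p ap y :
  @subst_aut n k a p ap y = subst a p y.
Proof. by []. Qed.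

Lemma substM a p (y w : Fnk n k) :
  subst a p (y * w) = subst a p y * subst a p w.
Proof. exact: gmulfM. Qed.

Lemma substV a p (y : Fnk n k) : subst a p y^-1 = (subst a p y)^-1.
Proof. exact: gmulfV. Qed.

Lemma move2_braidE (i j : 'I_n.-1) : j = i.+1 :> nat ->
  (forall e e', move2 i e e' (lo j) = e') *
  (forall e e', move2 j e e' (lo i) = x_ k (lo i)) *
  (forall e e', move2 i e e' (hi j) = x_ k (hi j)).
Proof.
move=> ij; have [lj ac bc] := succ_lo_hi ij.
split; [split|] => e e'; first by rewrite lj move2_hi.
  by rewrite move2_fix // lj lo_hi.
by rewrite move2_fix // eq_sym.
Qed.

Lemma move2_farE (i j : 'I_n.-1) : far i j ->
  (forall e e', move2 i e e' (lo j) = x_ k (lo j)) *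
  (forall e e', move2 i e e' (hi j) = x_ k (hi j)) *
  (forall e e', move2 j e e' (lo i) = x_ k (lo i)) *
  (forall e e', move2 j e e' (hi i) = x_ k (hi i)).
Proof.
move=> /far_neq[ac ad bc bd]; split; [split; [split|]|] => e e';
  by rewrite move2_fix // eq_sym.
Qed.

Lemma move2_bij i e e' d d' (p : {perm 'I_k}) :
    p * p = 1 ->
    subst (move2 i d d') p e = x_ k (lo i) ->
    subst (move2 i d d') p e' = x_ k (hi i) ->
    subst (move2 i e e') p d = x_ k (lo i) ->
    subst (move2 i e e') p d' = x_ k (hi i) ->
  bijective (subst (move2 i e e') p).
Proof.
move=> pp de de' ed ed'; apply: (@subst_bij _ _ _ _ (move2 i d d') p).
- move=> j; rewrite [X in subst _ _ X]/move2.
  case: (eqVneq j (lo i)) => [->//|jA].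
  by case: (eqVneq j (hi i)) => [->//|jB]; rewrite subst_x move2_fix.
- move=> j; rewrite [X in subst _ _ X]/move2.
  case: (eqVneq j (lo i)) => [->//|jA].
  by case: (eqVneq j (hi i)) => [->//|jB]; rewrite subst_x move2_fix.
by move=> t; rewrite -permM pp perm1.
Qed.

Lemma subst_aut_x a p ap j : @subst_aut n k a p ap (x_ k j) = a j.
Proof. exact: subst_x. Qed.

Definition fixes_off (i : 'I_n.-1) (f : aut (Fnk n k)) : Prop :=
  forall j, j != lo i -> j != hi i -> f (x_ k j) = x_ k j.

Lemma fixes_off_subst i e e' p ap :
  fixes_off i (@subst_aut n k (move2 i e e') p ap).
Proof. by move=> j jA jB; rewrite subst_aut_x move2_fix. Qed.

Lemma aut_far_comm i j (f g : aut (Fnk n k)) :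
    far i j -> fixes_off i f -> fixes_off j g ->
    [/\ g (f (x_ k (lo i))) = f (x_ k (lo i)),
        g (f (x_ k (hi i))) = f (x_ k (hi i)),
        f (g (x_ k (lo j))) = g (x_ k (lo j)) &
        f (g (x_ k (hi j))) = g (x_ k (hi j))] ->
    (forall t, g (f (z_ n t)) = f (g (z_ n t))) ->
  f * g = g * f.
Proof.
move=> /far_neq[ac ad bc bd] fi gj [e1 e2 e3 e4] ez.
apply: aut_Fnk_ext => t; rewrite !aut_mulE //.
case: (eqVneq t (lo i)) => [->|ta]; first by rewrite e1 (gj (lo i)).
case: (eqVneq t (hi i)) => [->|tb]; first by rewrite e2 (gj (hi i)).
case: (eqVneq t (lo j)) => [->|tc]; first by rewrite e3 fi // eq_sym.
case: (eqVneq t (hi j)) => [->|td]; first by rewrite e4 fi // eq_sym.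
by rewrite fi // gj // fi.
Qed.

Lemma aut_braid (i j : 'I_n.-1) (f1 f2 f3 g1 g2 g3 : aut (Fnk n k)) :
    j = i.+1 :> nat ->
    [/\ fixes_off i f1, fixes_off j f2 & fixes_off i f3] ->
    [/\ fixes_off j g1, fixes_off i g2 & fixes_off j g3] ->
    [/\ f3 (f2 (f1 (x_ k (lo i)))) = g3 (g2 (g1 (x_ k (lo i)))),
        f3 (f2 (f1 (x_ k (lo j)))) = g3 (g2 (g1 (x_ k (lo j)))) &
        f3 (f2 (f1 (x_ k (hi j)))) = g3 (g2 (g1 (x_ k (hi j))))] ->
    (forall t, f3 (f2 (f1 (z_ n t))) = g3 (g2 (g1 (z_ n t)))) ->
  f1 * f2 * f3 = g1 * g2 * g3.
Proof.
move=> ij [f1P f2P f3P] [g1P g2P g3P] [eA eB eC] ez.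
have [lj _ _] := succ_lo_hi ij.
apply: aut_Fnk_ext => t; rewrite !aut_mulE //.
case: (eqVneq t (lo i)) => [->//|tA].
case: (eqVneq t (lo j)) => [->//|tB].
case: (eqVneq t (hi j)) => [->//|tC].
by rewrite f1P -?lj // f2P // f3P -?lj // g1P // g2P -?lj // g3P.
Qed.

Lemma aut_square i (f : aut (Fnk n k)) :
    fixes_off i f ->
    f (f (x_ k (lo i))) = x_ k (lo i) -> f (f (x_ k (hi i))) = x_ k (hi i) ->
    (forall t, f (f (z_ n t)) = z_ n t) ->
  f * f = 1.
Proof.
move=> fi ea eb ez; apply: aut_Fnk_ext => t; rewrite aut_mulE aut_oneE //.
case: (eqVneq t (lo i)) => [->//|ta]; case: (eqVneq t (hi i)) => [->//|tb].
by rewrite !fi.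
Qed.

End LocalMoves.

Section PhiSW.
Variable n : nat.

Definition SW_v : 'I_n.+1 := ord0.
Definition SW_u (j : 'I_n) : 'I_n.+1 := lift ord0 j.

Local Notation F := (Fnk n n.+1).
Local Notation x := (x_ n.+1).
Local Notation v := (z_ n SW_v).
Local Notation u j := (z_ n (SW_u j)).
Local Notation u_swap := (transp SW_u).

Definition sigma_SW_img (i : 'I_n.-1) : 'I_n -> F :=
  move2 i (x (lo i) * x (hi i) ^ u (lo i) * (x (lo i))^-1 ^ (v * u (hi i)))
          (x (lo i) ^ v).

Definition rho_SW_img (i : 'I_n.-1) : 'I_n -> F :=
  move2 i (x (hi i)) (x (lo i)).

Fact SW_u_inj : injective SW_u.
Proof. exact: lift_inj. Qed.

Lemma u_swap_v i : u_swap i SW_v = SW_v.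
Proof. by apply: tpermD; rewrite eq_sym neq_lift. Qed.

Lemma u_swap_lo i : u_swap i (SW_u (lo i)) = SW_u (hi i).
Proof. exact: tpermL. Qed.

Lemma u_swap_hi i : u_swap i (SW_u (hi i)) = SW_u (lo i).
Proof. exact: tpermR. Qed.

Lemma u_swap_fix i j : j != lo i -> j != hi i -> u_swap i (SW_u j) = SW_u j.
Proof.
by move=> ji jj; apply: tpermD; rewrite (inj_eq SW_u_inj) eq_sym.
Qed.

Lemma u_swap_braidE (i j : 'I_n.-1) : j = i.+1 :> nat ->
  (u_swap i (SW_u (lo j)) = SW_u (lo i)) *
  (u_swap j (SW_u (lo i)) = SW_u (lo i)) *
  (u_swap i (SW_u (hi j)) = SW_u (hi j)).
Proof.
move=> ij; have [lj ac bc] := succ_lo_hi ij.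
by rewrite lj u_swap_hi !u_swap_fix // ?lj ?lo_hi // eq_sym.
Qed.

Lemma u_swap_farE (i j : 'I_n.-1) : far i j ->
  (u_swap i (SW_u (lo j)) = SW_u (lo j)) *
  (u_swap i (SW_u (hi j)) = SW_u (hi j)) *
  (u_swap j (SW_u (lo i)) = SW_u (lo i)) *
  (u_swap j (SW_u (hi i)) = SW_u (hi i)).
Proof.
by move=> /far_neq[ac ad bc bd]; rewrite !u_swap_fix // eq_sym.
Qed.

Local Notation E := (substM, substV, subst_x, subst_z,
  move2_lo, move2_hi, u_swap_v, u_swap_lo, u_swap_hi).

Fact sigma_SW_bij i : bijective (subst (sigma_SW_img i) (u_swap i)).
Proof.
apply: (@move2_bij _ _ _ _ _ (x (hi i) ^ v^-1)
  (((x (hi i))^-1 ^ v^-1 * x (lo i) * x (hi i) ^ u (lo i)) ^ (u (hi i))^-1));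
  first exact: transp2.
all: rewrite /conjg !E; mono_solve.
Qed.

Fact rho_SW_bij i : bijective (subst (rho_SW_img i) (u_swap i)).
Proof.
apply: (@move2_bij _ _ _ _ _ (x (hi i)) (x (lo i))); first exact: transp2.
all: by rewrite !E.
Qed.

Definition sigma_SW (i : 'I_n.-1) : aut F := subst_aut (sigma_SW_bij i).
Definition rho_SW (i : 'I_n.-1) : aut F := subst_aut (rho_SW_bij i).

Fact SW_relations : VB_relations sigma_SW rho_SW.
Proof.
have sF i : fixes_off i (sigma_SW i) by apply: fixes_off_subst.
have rF i : fixes_off i (rho_SW i) by apply: fixes_off_subst.
have braid3 (i j : 'I_n.-1) : j = i.+1 :> nat -> forall t,
    u_swap i (u_swap j (u_swap i t)) = u_swap j (u_swap i (u_swap j t)).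
  by move=> ij t; rewrite -!permM !mulgA (transp_braid SW_u_inj ij).
have comm2 i j : far i j -> forall t,
    u_swap j (u_swap i t) = u_swap i (u_swap j t).
  by move=> ij t; rewrite -!permM (transp_far SW_u_inj ij).
split=> [i j ij|i j ij|i j ij|i j ij|i j ij|i j ij|i].
1,2,3: apply: (aut_braid ij) => [//|//||t];
  last by rewrite !subst_autE !subst_z braid3.
1,2,3: have [lj _ _] := succ_lo_hi ij;
  split; rewrite /sigma_SW /rho_SW !subst_autE;
  rewrite /sigma_SW_img /rho_SW_img /conjg;
  rewrite !(E, esym lj, move2_braidE _ ij, u_swap_braidE ij); mono_solve.
1,2,3: apply: (aut_far_comm ij) => [//|//||t];
  last by rewrite !subst_autE !subst_z comm2.
1,2,3: split; rewrite /sigma_SW /rho_SW !subst_autE;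
  rewrite /sigma_SW_img /rho_SW_img /conjg;
  rewrite !(E, move2_farE _ ij, u_swap_farE ij); mono_solve.
apply: (aut_square (rF i)) => [||t]; rewrite !subst_autE.
1,2: by rewrite /rho_SW_img !E.
by rewrite !subst_z -permM transp2 perm1.
Qed.

Definition phi_SW : {gmorphism VB n -> aut F} := VB_lift SW_relations.

End PhiSW.


Section PhiBD.
Variable n : nat.

Definition BD_u : 'I_2 := ord0.
Definition BD_v : 'I_2 := ord_max.

Local Notation F := (Fnk n 2).
Local Notation x := (x_ 2).
Local Notation u := (z_ n BD_u).
Local Notation v := (z_ n BD_v).

Definition sigma_BD_img (i : 'I_n.-1) : 'I_n -> F :=
  move2 i (x (lo i) * x (hi i) * (x (lo i))^-1 ^ u) (x (lo i) ^ u).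

Definition rho_BD_img (i : 'I_n.-1) : 'I_n -> F :=
  move2 i (x (hi i) ^ v^-1) (x (lo i) ^ v).

Local Notation E := (substM, substV, subst_x, subst_z, move2_lo, move2_hi,
  perm1).

Fact sigma_BD_bij i : bijective (subst (sigma_BD_img i) 1).
Proof.
apply: (@move2_bij _ _ _ _ _ (x (hi i) ^ u^-1)
  ((x (hi i))^-1 ^ u^-1 * x (lo i) * x (hi i))); first exact: mulg1.
all: rewrite /conjg !E; mono_solve.
Qed.

Fact rho_BD_bij i : bijective (subst (rho_BD_img i) 1).
Proof.
apply: (@move2_bij _ _ _ _ _ (x (hi i) ^ v^-1) (x (lo i) ^ v));
  first exact: mulg1.
all: rewrite /conjg !E; mono_solve.
Qed.

Definition sigma_BD (i : 'I_n.-1) : aut F := subst_aut (sigma_BD_bij i).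
Definition rho_BD (i : 'I_n.-1) : aut F := subst_aut (rho_BD_bij i).

Fact BD_relations : VB_relations sigma_BD rho_BD.
Proof.
have sF i : fixes_off i (sigma_BD i) by apply: fixes_off_subst.
have rF i : fixes_off i (rho_BD i) by apply: fixes_off_subst.
split=> [i j ij|i j ij|i j ij|i j ij|i j ij|i j ij|i].
1,2,3: apply: (aut_braid ij) => [//|//||t];
  last by rewrite !subst_autE !subst_z.
1,2,3: have [lj _ _] := succ_lo_hi ij;
  split; rewrite /sigma_BD /rho_BD !subst_autE;
  rewrite /sigma_BD_img /rho_BD_img /conjg;
  rewrite !(E, esym lj, move2_braidE _ ij); mono_solve.
1,2,3: apply: (aut_far_comm ij) => [//|//||t];
  last by rewrite !subst_autE !subst_z.
1,2,3: split; rewrite /sigma_BD /rho_BD !subst_autE;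
  rewrite /sigma_BD_img /rho_BD_img /conjg;
  rewrite !(E, move2_farE _ ij); mono_solve.
apply: (aut_square (rF i)) => [||t]; rewrite !subst_autE.
1,2: rewrite /rho_BD_img /conjg !E; mono_solve.
by rewrite !subst_z !perm1.
Qed.

Definition phi_BD : {gmorphism VB n -> aut F} := VB_lift BD_relations.

End PhiBD.

Section PhiM.
Variable n : nat.

Local Notation F := (Fnk n n).
Local Notation y := (x_ n).
Local Notation v := (@z_ n n).
Local Notation v_swap := (transp (@id 'I_n)).

Definition sigma_M_img (i : 'I_n.-1) : 'I_n -> F :=
  move2 i (y (lo i) * y (hi i) * (y (lo i))^-1) (y (lo i)).

Definition rho_M_img (i : 'I_n.-1) : 'I_n -> F :=
  move2 i (y (hi i) ^ (v (lo i))^-1) (y (lo i) ^ v (hi i)).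

Lemma v_swap_lo i : v_swap i (lo i) = hi i.
Proof. exact: tpermL. Qed.

Lemma v_swap_hi i : v_swap i (hi i) = lo i.
Proof. exact: tpermR. Qed.

Lemma v_swap_fix i j : j != lo i -> j != hi i -> v_swap i j = j.
Proof. by move=> ji jj; apply: tpermD; rewrite eq_sym. Qed.

Lemma v_swap_braidE (i j : 'I_n.-1) : j = i.+1 :> nat ->
  (v_swap i (lo j) = lo i) * (v_swap j (lo i) = lo i) *
  (v_swap i (hi j) = hi j).
Proof.
move=> ij; have [lj ac bc] := succ_lo_hi ij.
by rewrite lj v_swap_hi !v_swap_fix // ?lj ?lo_hi // eq_sym.
Qed.

Lemma v_swap_farE (i j : 'I_n.-1) : far i j ->
  (v_swap i (lo j) = lo j) * (v_swap i (hi j) = hi j) *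
  (v_swap j (lo i) = lo i) * (v_swap j (hi i) = hi i).
Proof. by move=> /far_neq[ac ad bc bd]; rewrite !v_swap_fix // eq_sym. Qed.

Local Notation E := (substM, substV, subst_x, subst_z, move2_lo, move2_hi,
  v_swap_lo, v_swap_hi).

Fact sigma_M_bij i : bijective (subst (sigma_M_img i) (v_swap i)).
Proof.
apply: (@move2_bij _ _ _ _ _ (y (hi i))
  ((y (hi i))^-1 * y (lo i) * y (hi i))); first exact: transp2.
all: rewrite !E; mono_solve.
Qed.

Fact rho_M_bij i : bijective (subst (rho_M_img i) (v_swap i)).
Proof.
apply: (@move2_bij _ _ _ _ _ (y (hi i) ^ (v (lo i))^-1)
  (y (lo i) ^ v (hi i))); first exact: transp2.
all: rewrite /conjg !E; mono_solve.
Qed.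

Definition sigma_M (i : 'I_n.-1) : aut F := subst_aut (sigma_M_bij i).
Definition rho_M (i : 'I_n.-1) : aut F := subst_aut (rho_M_bij i).

Fact M_relations : VB_relations sigma_M rho_M.
Proof.
have sF i : fixes_off i (sigma_M i) by apply: fixes_off_subst.
have rF i : fixes_off i (rho_M i) by apply: fixes_off_subst.
have braid3 (i j : 'I_n.-1) : j = i.+1 :> nat -> forall t,
    v_swap i (v_swap j (v_swap i t)) = v_swap j (v_swap i (v_swap j t)).
  by move=> ij t; rewrite -!permM !mulgA (transp_braid (@inj_id 'I_n) ij).
have comm2 i j : far i j -> forall t,
    v_swap j (v_swap i t) = v_swap i (v_swap j t).
  by move=> ij t; rewrite -!permM (transp_far (@inj_id 'I_n) ij).
split=> [i j ij|i j ij|i j ij|i j ij|i j ij|i j ij|i].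
1,2,3: apply: (aut_braid ij) => [//|//||t];
  last by rewrite !subst_autE !subst_z braid3.
1,2,3: have [lj _ _] := succ_lo_hi ij;
  split; rewrite /sigma_M /rho_M !subst_autE;
  rewrite /sigma_M_img /rho_M_img /conjg;
  rewrite !(E, esym lj, move2_braidE _ ij, v_swap_braidE ij); mono_solve.
1,2,3: apply: (aut_far_comm ij) => [//|//||t];
  last by rewrite !subst_autE !subst_z comm2.
1,2,3: split; rewrite /sigma_M /rho_M !subst_autE;
  rewrite /sigma_M_img /rho_M_img /conjg;
  rewrite !(E, move2_farE _ ij, v_swap_farE ij); mono_solve.
apply: (aut_square (rF i)) => [||t]; rewrite !subst_autE.
1,2: rewrite /rho_M_img /conjg !E; mono_solve.
by rewrite !subst_z -permM transp2 perm1.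
Qed.

Definition phi_M : {gmorphism VB n -> aut F} := VB_lift M_relations.

End PhiM.

Arguments phi_SW : clear implicits.
Arguments phi_BD : clear implicits.
Arguments phi_M : clear implicits.

(* (sigma_2^-1 rho_1 sigma_2 rho_3)^3, with indices shifted to start from 0. *)
Definition beta : VB 4 :=
  let i1 : 'I_4.-1 := @Ordinal 3 0 isT in
  let i2 : 'I_4.-1 := @Ordinal 3 1 isT in
  let i3 : 'I_4.-1 := @Ordinal 3 2 isT in
  ((sigma i2)^-1 * rho i1 * sigma i2 * rho i3) ^+ 3.

(* Main.v *)
(* Put g = sigma_j^-1 rho_i sigma_j rho_k with j = i+1 and k = j+1, so that beta
   is g^3 for i = 1. On strands, g is the 3-cycle (i,k)(k,k+1). Under all three
   representations the image of g fixes the j-th free generator a and sends the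
   other three around this cycle, up to multiplication and conjugation by words
   in a and the abelian generators. Over one full turn these words cancel for
   phi_SW and phi_BD. For phi_M, g^3 sends y_(k+1) to w y_(k+1) w^-1, where
   w = (y_j^-1)^(v_i) y_j^(v_k); mapping all y's to (0 1), v_i to (1 2) and the
   other v's to 1 gives a homomorphism to S_3 which separates the two. *)
From mathcomp Require Import all_boot fingroup perm.
From mathcomp Require Import zify.
Require Import Defs.

Set Implicit Arguments.
Unset Strict Implicit.
Unset Printing Implicit Defensive.

Local Open Scope group_scope.

(** * Evaluating the word in an arbitrary group *)

Lemma aut_inv_eq (G : groupType) (f : aut G) (y w : G) :
  f y = w -> f^-1 w = y.
Proof. by move=> <-; rewrite -aut_mulE mulgV. Qed.

Lemma autV (G : groupType) (f : aut G) (y : G) : f y^-1 = (f y)^-1.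
Proof. exact: (gmulfV (aut_morph f)). Qed.

Definition twist n (H : groupType) (sg rh : 'I_n.-1 -> H)
    (i j k : 'I_n.-1) : H :=
  (sg j)^-1 * rh i * sg j * rh k.

Lemma beta_twist :
  beta = twist (@sigma 4) (@rho 4) (@Ordinal 3 0 isT) (@Ordinal 3 1 isT)
           (@Ordinal 3 2 isT) ^+ 3.
Proof. by []. Qed.

Lemma gmulf_twist n (G H : groupType) (f : {gmorphism G -> H}) sg rh
    (i j k : 'I_n.-1) :
  f (twist sg rh i j k) = twist (f \o sg) (f \o rh) i j k.
Proof. by rewrite /twist !gmulfM gmulfV. Qed.

(** The equation on [f] holds by unfolding for named maps such as [phi_SW]. *)
Lemma VB_lift_twist_cube n (H : groupType) (sg rh : 'I_n.-1 -> H)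
    (srP : VB_relations sg rh) (f : {gmorphism VB n -> H}) i j k :
    f = VB_lift srP :> (VB n -> H) ->
  f (twist (@sigma n) (@rho n) i j k ^+ 3) = twist sg rh i j k ^+ 3.
Proof.
move=> fE; rewrite gmulfXn gmulf_twist /twist /= fE.
by rewrite !(VB_lift_sigma srP) !(VB_lift_rho srP).
Qed.

Lemma aut_cubeE (G : groupType) (f : aut G) (x : G) :
  (f ^+ 3) x = f (f (f x)).
Proof. by rewrite !expgS expg0 mulg1. Qed.

Section Twist.
Variables (n : nat) (i j k : 'I_n.-1).
Hypotheses (ij : j = i.+1 :> nat) (jk : k = j.+1 :> nat).

Let far_ik : far i k. Proof. by rewrite /far; lia. Qed.
(** The four strands are written [lo i], [lo j], [lo k], [hi k] throughout; [hi i] and [hi j] are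
    rewritten to these. *)
Let lj : lo j = hi i. Proof. by have [] := succ_lo_hi ij. Qed.
Let lk : lo k = hi j. Proof. by have [] := succ_lo_hi jk. Qed.

Local Notation E := (esym lj, esym lk, substM, substV, subst_x, subst_z,
  move2_lo, move2_hi, move2_farE _ far_ik, move2_braidE _ ij,
  move2_braidE _ jk).

(** * The induced permutation *)

Section Transpositions.
Variables (m : nat) (f : 'I_n -> 'I_m).
Hypothesis f_inj : injective f.

(** The first three factors conjugate [(lo i, lo j)] by [(lo j, lo k)], which gives
    [(lo i, lo k)]. *)
Lemma twist_transp :
  twist (transp f) (transp f) i j k =
    tperm (f (lo i)) (f (lo k)) * tperm (f (lo k)) (f (hi k)).
Proof.
have [_ ac bc] := succ_lo_hi ij.
rewrite /twist -[_ * transp f j]mulgA -conjgE /transp tpermJ -lj tpermL lk.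
by rewrite tpermD // (inj_eq f_inj) eq_sym // lj lo_hi.
Qed.

(** The last clause handles indices outside the range of [f], such as that of [v] when [f] is
    [SW_u]. *)
Lemma twist_transpE :
  let p := twist (transp f) (transp f) i j k in
  [/\ p (f (lo i)) = f (hi k), p (f (lo j)) = f (lo j),
      p (f (lo k)) = f (lo i), p (f (hi k)) = f (lo k) &
      forall t, (forall s, t != f s) -> p t = t].
Proof.
have [ac ad bc bd] := far_neq far_ik; have ab := lo_hi i.
rewrite twist_transp; split=> [||||t ft]; rewrite permM.
- by rewrite !tpermL.
- by rewrite !tpermD ?(inj_eq f_inj) ?lj // eq_sym.
- by rewrite tpermR tpermD ?(inj_eq f_inj) // eq_sym.
- by rewrite [tperm _ _ (f (hi k))]tpermD ?tpermR ?(inj_eq f_inj) ?lo_hi.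
- by rewrite !tpermD // eq_sym.
Qed.

Lemma twist_transp_cube : twist (transp f) (transp f) i j k ^+ 3 = 1.
Proof.
have [ac ad _ _] := far_neq far_ik; have cd := lo_hi k.
move: ac ad cd; rewrite twist_transp.
rewrite -!(inj_eq f_inj) => /eqP ac /eqP ad /eqP cd.
apply/permP => t; rewrite !expgS expg0 mulg1 !permM perm1.
by repeat case: tpermP; intros; congruence.
Qed.

End Transpositions.

(** * Reduction to the four generators involved *)

Section SubstitutionFamilies.
Variables (m : nat) (a b : 'I_n.-1 -> 'I_n -> Fnk n m).
Variable p : 'I_n.-1 -> {perm 'I_m}.
Hypotheses (aP : forall t, bijective (subst (a t) (p t)))
           (bP : forall t, bijective (subst (b t) (p t))).
Local Notation sg := (fun t => subst_aut (aP t)).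
Local Notation rh := (fun t => subst_aut (bP t)).

Lemma twist_subst_z t :
  twist sg rh i j k (z_ n t) = z_ n (twist p p i j k t).
Proof.
rewrite /twist !aut_mulE; have -> : (sg j)^-1 (z_ n t) = z_ n ((p j)^-1 t).
  by apply: aut_inv_eq; rewrite subst_autE subst_z permKV.
by rewrite !subst_autE !subst_z -!permM !mulgA.
Qed.

(** Every factor fixes the remaining free generators, and [sg] and [rh] permute the abelian ones by
    the same [p]. *)
Lemma twist_subst_cube :
    (forall t, fixes_off t (sg t)) -> (forall t, fixes_off t (rh t)) ->
    twist p p i j k ^+ 3 = 1 ->
    let f := twist sg rh i j k in
    [/\ f (f (f (x_ m (lo i)))) = x_ m (lo i),
        f (f (f (x_ m (lo j)))) = x_ m (lo j),
        f (f (f (x_ m (lo k)))) = x_ m (lo k) &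
        f (f (f (x_ m (hi k)))) = x_ m (hi k)] ->
  f ^+ 3 = 1.
Proof.
move=> sgP rhP p3 /= [fa fb fc fd].
apply: aut_Fnk_ext => t; rewrite aut_cubeE aut_oneE; last first.
  by rewrite !twist_subst_z -!permM -[_ * _ * _]/(_ ^+ 3) p3 perm1.
case: (eqVneq t (lo i)) => [->//|ta]; case: (eqVneq t (lo j)) => [->//|tb].
case: (eqVneq t (lo k)) => [->//|tc]; case: (eqVneq t (hi k)) => [->//|td].
have sgE : sg j (x_ m t) = x_ m t by apply: sgP; rewrite // -lk.
suff ft : twist sg rh i j k (x_ m t) = x_ m t by rewrite !ft.
rewrite /twist !aut_mulE (aut_inv_eq sgE) rhP ?sgE ?rhP //.
by rewrite -lj.
Qed.

End SubstitutionFamilies.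

(** * The representation [phi_SW] *)

Section SW.

Local Notation x := (x_ n.+1).
Local Notation v := (z_ n (SW_v n)).
Local Notation u t := (z_ n (SW_u t)).
Local Notation g := (twist (@sigma_SW n) (@rho_SW n) i j k).
Local Notation swapE := (u_swap_v, u_swap_lo, u_swap_hi,
  u_swap_farE far_ik, u_swap_braidE ij, u_swap_braidE jk).

(** Inverses in [aut] come from choice and do not compute; each preimage is certified by applying
    [sigma_SW j] to it. *)
Lemma sigma_SW_inv :
  ((sigma_SW j)^-1 (x (lo i)) = x (lo i)) *
  ((sigma_SW j)^-1 (x (lo j)) = x (lo k) ^ v^-1) *
  ((sigma_SW j)^-1 (x (lo k)) =
     ((x (lo k))^-1 ^ v^-1 * x (lo j) * x (lo k) ^ u (lo j)) ^ (u (lo k))^-1) *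
  ((sigma_SW j)^-1 (x (hi k)) = x (hi k)).
Proof.
do !split; apply: aut_inv_eq.
all: rewrite subst_autE /sigma_SW_img /conjg !(E, swapE); mono_solve.
Qed.

Lemma twist_SW_z :
  (g v = v) * (g (u (lo i)) = u (hi k)) * (g (u (lo j)) = u (lo j)) *
  (g (u (lo k)) = u (lo i)) * (g (u (hi k)) = u (lo k)).
Proof.
have [pa pb pc pd pf] := twist_transpE (@SW_u_inj n).
by do !split; rewrite [LHS]twist_subst_z ?pa ?pb ?pc ?pd ?pf.
Qed.

(** Factors act from left to right, so the inverse meets only single generators and [sigma_SW_inv]
    eliminates it. *)
Lemma twist_SW_x :
  (g (x (lo i)) =
     x (lo j) * x (hi k) ^ u (lo j) * (x (lo j))^-1 ^ (v * u (hi k))) *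
  (g (x (lo j)) = x (lo j)) *
  (g (x (lo k)) =
     ((x (lo j))^-1 * x (lo i) * x (lo j) ^ (v * u (lo i))) ^ (u (lo j))^-1) *
  (g (x (hi k)) = x (lo k)).
Proof.
rewrite /twist !aut_mulE !sigma_SW_inv /sigma_SW /rho_SW !subst_autE.
rewrite /sigma_SW_img /rho_SW_img /conjg.
by do !split; rewrite !(E, swapE); mono_solve.
Qed.

Lemma twist_SW_cube : g ^+ 3 = 1.
Proof.
have gx3 : [/\ g (g (g (x (lo i)))) = x (lo i), g (g (g (x (lo j)))) = x (lo j),
               g (g (g (x (lo k)))) = x (lo k) & g (g (g (x (hi k)))) = x (hi k)].
  (* Starting from [x (lo i)], the exponent [v * u (hi k)] travels to [v * u (lo k)] and then
     [v * u (lo i)], where it cancels the factor brought in by the image of [x (lo k)]. *)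
  move: twist_SW_x twist_SW_z (autM g) (autV g); rewrite /conjg.
  by generalize g => f fx fz fM fV; split; rewrite !(fx, fz, fM, fV); mono_solve.
apply: twist_subst_cube gx3 => [t|t|].
- exact: fixes_off_subst.
- exact: fixes_off_subst.
- exact/twist_transp_cube/SW_u_inj.
Qed.

End SW.

(** * The representation [phi_BD] *)

Section BD.

Local Notation x := (x_ 2).
Local Notation u := (z_ n BD_u).
Local Notation v := (z_ n BD_v).
Local Notation g := (twist (@sigma_BD n) (@rho_BD n) i j k).

Lemma sigma_BD_inv :
  ((sigma_BD j)^-1 (x (lo i)) = x (lo i)) *
  ((sigma_BD j)^-1 (x (lo j)) = x (lo k) ^ u^-1) *
  ((sigma_BD j)^-1 (x (lo k)) =
     (x (lo k))^-1 ^ u^-1 * x (lo j) * x (lo k)) *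
  ((sigma_BD j)^-1 (x (hi k)) = x (hi k)).
Proof.
do !split; apply: aut_inv_eq.
all: rewrite subst_autE /sigma_BD_img /conjg !(E, perm1); mono_solve.
Qed.

Lemma twist_BD_z t : g (z_ n t) = z_ n t.
Proof. by rewrite [LHS]twist_subst_z /twist mulVg !mulg1 perm1. Qed.

Lemma twist_BD_x :
  (g (x (lo i)) =
     (x (lo j) * x (hi k) ^ v^-1 * (x (lo j))^-1 ^ u) ^ v^-1) *
  (g (x (lo j)) = x (lo j)) *
  (g (x (lo k)) = (x (lo j))^-1 * x (lo i) ^ v * x (lo j) ^ u) *
  (g (x (hi k)) = x (lo k) ^ v).
Proof.
rewrite /twist !aut_mulE !sigma_BD_inv /sigma_BD /rho_BD !subst_autE.
rewrite /sigma_BD_img /rho_BD_img /conjg.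
by do !split; rewrite !(E, perm1); mono_solve.
Qed.

Lemma twist_BD_cube : g ^+ 3 = 1.
Proof.
have gx3 : [/\ g (g (g (x (lo i)))) = x (lo i), g (g (g (x (lo j)))) = x (lo j),
               g (g (g (x (lo k)))) = x (lo k) & g (g (g (x (hi k)))) = x (hi k)].
  move: twist_BD_x twist_BD_z (autM g) (autV g); rewrite /conjg.
  by generalize g => f fx fz fM fV; split; rewrite !(fx, fz, fM, fV); mono_solve.
apply: twist_subst_cube gx3 => [t|t|].
- exact: fixes_off_subst.
- exact: fixes_off_subst.
- by rewrite /twist mulVg !mulg1 expg1n.
Qed.

End BD.

(** * The representation [phi_M] *)

Section M.

Local Notation y := (x_ n).
Local Notation v := (@z_ n n).
Local Notation g := (twist (@sigma_M n) (@rho_M n) i j k).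
Local Notation swapE := (v_swap_lo, v_swap_hi,
  v_swap_farE far_ik, v_swap_braidE ij, v_swap_braidE jk).

Lemma sigma_M_inv :
  ((sigma_M j)^-1 (y (lo i)) = y (lo i)) *
  ((sigma_M j)^-1 (y (lo j)) = y (lo k)) *
  ((sigma_M j)^-1 (y (lo k)) = (y (lo k))^-1 * y (lo j) * y (lo k)) *
  ((sigma_M j)^-1 (y (hi k)) = y (hi k)).
Proof.
do !split; apply: aut_inv_eq.
all: rewrite subst_autE /sigma_M_img /conjg !(E, swapE); mono_solve.
Qed.

Lemma twist_M_z :
  (g (v (lo i)) = v (hi k)) * (g (v (lo j)) = v (lo j)) *
  (g (v (lo k)) = v (lo i)) * (g (v (hi k)) = v (lo k)).
Proof.
have [pa pb pc pd _] := twist_transpE (@inj_id 'I_n).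
do !split; rewrite [LHS]twist_subst_z; congr z_.
all: by [exact: pa|exact: pb|exact: pc|exact: pd].
Qed.

Lemma twist_M_x :
  (g (y (lo i)) =
     (y (lo j) * y (hi k) ^ (v (lo k))^-1 * (y (lo j))^-1) ^ (v (lo i))^-1) *
  (g (y (lo j)) = y (lo j)) *
  (g (y (lo k)) = (y (lo j))^-1 * y (lo i) ^ v (hi k) * y (lo j)) *
  (g (y (hi k)) = y (lo k) ^ v (hi k)).
Proof.
rewrite /twist !aut_mulE !sigma_M_inv /sigma_M /rho_M !subst_autE.
rewrite /sigma_M_img /rho_M_img /conjg.
by do !split; rewrite !(E, swapE); mono_solve.
Qed.

(** The two letters from [y (lo j)] end up conjugated by the different generators [v (lo i)] and
    [v (lo k)], so they do not cancel. *)
Lemma twist_M_cube_hi :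
  let w := (y (lo j))^-1 ^ v (lo i) * y (lo j) ^ v (lo k) in
  (g ^+ 3) (y (hi k)) = w * y (hi k) * w^-1.
Proof.
rewrite aut_cubeE; move: twist_M_x twist_M_z (autM g) (autV g).
rewrite /conjg; generalize g => f fx fz fM fV.
by rewrite !(fx, fz, fM, fV); mono_solve.
Qed.

Lemma twist_M_cube_neq1 : g ^+ 3 != 1.
Proof.
apply/eqP => /(congr1 (fun f : aut _ => f (y (hi k)))).
rewrite twist_M_cube_hi aut_oneE.
pose a : {perm 'I_3} := tperm (@Ordinal 3 0 isT) (@Ordinal 3 1 isT).
pose b : {perm 'I_3} := tperm (@Ordinal 3 1 isT) (@Ordinal 3 2 isT).
(* Sending all abelian generators to powers of the single [b] keeps their images commuting. *)
pose c t := if t == lo i then b else 1.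
have cC s t : commute (c s) (c t).
  rewrite /c; case: ifP => _; last exact: commute_sym (commute1 _).
  by case: ifP => _; last exact: commute1.
move/(congr1 (Flift (fun=> a) cC)).
have [ik _ _ _] := far_neq far_ik.
rewrite /conjg !(gmulfM, gmulfV) !Flift_x !Flift_z /c eqxx eq_sym (negbTE ik).
(* Now [w] has become the 3-cycle [a ^ b * a]; its conjugate [w * a * w^-1] fixes 0, while [a] moves
   it. *)
rewrite mulg1 invg1 mul1g => /permP/(_ (@Ordinal 3 0 isT))/eqP.
by rewrite !invgM !invgK !tpermV !permM !permE.
Qed.

End M.

End Twist.

Theorem proposition5 :
  [/\ beta \in VP 4,
      beta \in kernel (phi_SW 4),
      beta \in kernel (phi_BD 4)
    & beta \notin kernel (phi_M 4)].
Proof.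
rewrite !inE beta_twist; split.
- apply/eqP.
  rewrite (VB_lift_twist_cube (srP := transp_relations (@inj_id 'I_4))) //.
  exact: twist_transp_cube.
- apply/eqP; rewrite (VB_lift_twist_cube (srP := SW_relations 4)) //.
  exact: twist_SW_cube.
- apply/eqP; rewrite (VB_lift_twist_cube (srP := BD_relations 4)) //.
  exact: twist_BD_cube.
rewrite (VB_lift_twist_cube (srP := M_relations 4)) //.
exact: twist_M_cube_neq1.
Qed.
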